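(* Let $\mathcal{C}$ be a category with covers and $\mathcal{R}$ an equivalence relation on $\mathrm{Mor}_{\mathcal{C}}(c,c')$ for each $c,c'\in\mathcal{C}$; let $\mathcal{D}$ be a category with covers and $\mathcal{R}'$ an equivalence relation on $\mathrm{Mor}_{\mathcal{D}}(d,d')$ for each $d,d'\in\mathcal{D}$. Let $\mathfrak{F}:\mathcal{C}\to\mathcal{D}$ be a continuous functor such that $\mathfrak{F}(f)\,\mathcal{R}'\,\mathfrak{F}(g)$ whenever $f\,\mathcal{R}\,g$. Then for every morphism $f:X\to Y$ in $\mathcal{C}$, $$\mathcal{R}'\text{-}\mathrm{sec}(\mathfrak{F}(f))\leq\mathcal{R}\text{-}\mathrm{sec}(f).$$ Furthermore, if $\mathfrak{F}$ preserves monomorphisms, then $$\mathcal{R}'\text{-}\mathrm{msec}(\mathfrak{F}(f))\leq\mathcal{R}\text{-}\mathrm{msec}(f).$$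
   Context: Sieves and covers: for a category $\mathcal{C}$ and an object $C$, the overcategory $\mathcal{C}_{|C}$ has as objects the morphisms with codomain $C$. A sieve on $C$ is a full subcategory $S\subset\mathcal{C}_{|C}$ (i.e. a class of morphisms with codomain $C$) such that $f\in S$ implies $f\circ g\in S$ for every $g$ with $\mathrm{codom}(g)=\mathrm{dom}(f)$. The sieve generated by a family $\{f_i:C_i\to C\}_{i\in I}$ consists of all $g:D\to C$ that factor as $D\to C_i\xrightarrow{f_i}C$ for some $i\in I$. A topology on $\mathcal{C}$ assigns to each object $C$ a collection of sieves on $C$, called covering sieves (no axioms are required); a category equipped with a topology is a category with covers. A family $\{f_i:C_i\to C\}_{i\in I}$ is a covering for $C$ if it generates a covering sieve on $C$. A functor $\mathfrak{F}:\mathcal{C}\to\mathcal{D}$ between categories with covers is continuous if, whenever $\{i_\lambda:A_\lambda\to X\}_{\lambda\in\Lambda}$ is a covering for $X$ in $\mathcal{C}$, the family $\{\mathfrak{F}(i_\lambda):\mathfrak{F}(A_\lambda)\to\mathfrak{F}(X)\}_{\lambda\in\Lambda}$ is a covering for $\mathfrak{F}(X)$ in $\mathcal{D}$. Given $f:X\to Y$ and $g:Z\to Y$, an $\mathcal{R}$-$g$-section of $f$ is a morphism $s:Z\to X$ with $(f\circ s)\,\mathcal{R}\,g$. $\mathcal{R}\text{-}\mathrm{sec}(f)$ is the least integer $m\ge 1$ such that there is a covering $\{g_j:Y_j\to Y\}_{j=1}^m$ for $Y$ such that $f$ admits an $\mathcal{R}$-$g_j$-section for each $j$; $\mathcal{R}\text{-}\mathrm{msec}(f)$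 is defined in the same way with the additional requirement that each $g_j$ is a monomorphism. Each is $\infty$ if no such $m$ exists. The numbers $\mathcal{R}'\text{-}\mathrm{sec}$ and $\mathcal{R}'\text{-}\mathrm{msec}$ in $\mathcal{D}$ are defined likewise. *)

(* Defs.v *)
From Corelib Require Export RelationClasses.
From mathcomp Require Export all_boot.
From mathcomp Require Import boolp.

Set Implicit Arguments.
Unset Strict Implicit.
Unset Printing Implicit Defensive.

Record category := Category {
  obj :> Type;
  hom : obj -> obj -> Type;
  idm : forall X, hom X X;
  cmp : forall X Y Z, hom Y Z -> hom X Y -> hom X Z;
  cmp_idl : forall X Y (f : hom X Y), cmp (idm Y) f = f;
  cmp_idr : forall X Y (f : hom X Y), cmp f (idm X) = f;
  cmpA : forall W X Y Z (h : hom Y Z) (g : hom X Y) (f : hom W X),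
    cmp h (cmp g f) = cmp (cmp h g) f }.

Definition mono (C : category) (X Y : C) (f : hom X Y) : Prop :=
  forall (Z : C) (g h : hom Z X), cmp f g = cmp f h -> g = h.

Record functor (C D : category) := Functor {
  fobj :> C -> D;
  fmap : forall X Y : C, hom X Y -> hom (fobj X) (fobj Y);
  fmap_id : forall X : C, fmap (idm X) = idm (fobj X);
  fmap_cmp : forall (X Y Z : C) (g : hom Y Z) (f : hom X Y),
    fmap (cmp g f) = cmp (fmap g) (fmap f) }.

Definition preserves_mono (C D : category) (F : functor C D) : Prop :=
  forall (X Y : C) (f : hom X Y), mono f -> mono (fmap F f).

(* A full subcategory of the overcategory of X is given by its class of
   objects, i.e. by a class of morphisms with codomain X. *)
Record sieve (C : category) (X : C) := Sieve {
  in_sieve : forall Y : C, hom Y X -> Prop;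
  sieve_closed : forall (Y Z : C) (f : hom Y X) (g : hom Z Y),
    in_sieve f -> in_sieve (cmp f g) }.

Definition factors_through (C : category) (X : C) (I : Type) (A : I -> C)
    (f : forall i, hom (A i) X) (Y : C) (g : hom Y X) : Prop :=
  exists (i : I) (h : hom Y (A i)), g = cmp (f i) h.

Lemma factors_through_closed (C : category) (X : C) (I : Type) (A : I -> C)
    (f : forall i, hom (A i) X) (Y Z : C) (g : hom Y X) (k : hom Z Y) :
  factors_through f g -> factors_through f (cmp g k).
Proof. by move=> [i [h ->]]; exists i, (cmp h k); rewrite cmpA. Qed.

Definition gen_sieve (C : category) (X : C) (I : Type) (A : I -> C)
    (f : forall i, hom (A i) X) : sieve X :=
  Sieve (@factors_through_closed C X I A f).

Record cat_with_covers := CatWithCovers {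
  cat_of :> category;
  covering_sieve : forall X : cat_of, sieve X -> Prop }.

Definition covering (C : cat_with_covers) (X : C) (I : Type) (A : I -> C)
    (f : forall i, hom (A i) X) : Prop :=
  covering_sieve (gen_sieve f).

Definition continuous_functor (C D : cat_with_covers) (F : functor C D) :
    Prop :=
  forall (X : C) (I : Type) (A : I -> C) (f : forall i, hom (A i) X),
    covering f -> @covering D (F X) I (fun i => F (A i)) (fun i => fmap F (f i)).

Inductive enat := Fin of nat | Infty.

Definition le_enat (x y : enat) : bool :=
  match x, y with
  | _, Infty => true
  | Fin m, Fin n => m <= n
  | Infty, Fin _ => false
  end.

Definition least (P : nat -> Prop) : enat :=
  match pselect (exists n, `[< P n >]) with
  | left exP => Fin (ex_minn exP)
  | right _ => Infty
  end.

Definition hom_rel (C : category) := forall X Y : C, hom X Y -> hom X Y -> Prop.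

Definition hom_equivalence (C : category) (R : hom_rel C) : Prop :=
  forall X Y : C, Equivalence (R X Y).

Definition is_section (C : category) (R : hom_rel C) (X Y Z : C)
    (f : hom X Y) (g : hom Z Y) (s : hom Z X) : Prop :=
  R Z Y (cmp f s) g.

Definition sec (C : cat_with_covers) (R : hom_rel C) (X Y : C) (f : hom X Y) :
    enat :=
  least (fun m => 1 <= m /\
    exists (A : 'I_m -> C) (g : forall j, hom (A j) Y),
      covering g /\ forall j, exists s : hom (A j) X, is_section R f (g j) s).

Definition msec (C : cat_with_covers) (R : hom_rel C) (X Y : C) (f : hom X Y) :
    enat :=
  least (fun m => 1 <= m /\
    exists (A : 'I_m -> C) (g : forall j, hom (A j) Y),
      [/\ covering g,
          forall j, mono (g j) &
          forall j, exists s : hom (A j) X, is_section R f (g j) s]).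

(* Main.v *)
Require Import Defs.
From mathcomp Require Import boolp.

(** Applying [F] to a covering of [Y] by [m] morphisms along which [f] has sections gives, by
    continuity, a covering of [F Y] by [m] morphisms, and [fmap_is_section] carries the sections
    along. So every [m] admissible for [f] is admissible for [fmap F f], and [le_least] turns this
    inclusion into the inequality of minima, infinite values included. *)

Lemma le_least (P Q : nat -> Prop) :
  (forall m, P m -> Q m) -> le_enat (least Q) (least P).
Proof.
move=> PQ; rewrite /least.
(* If [P] has no witness, the upper bound is [Infty] and nothing is left to compare. *)
case: (pselect (exists n, `[< P n >])) => [exP | _]; last by case: pselect.
case: pselect => [exQ | []] /=; last first.
  by case: exP => n /asboolP Pn; exists n; apply/asboolP/PQ.
case: ex_minnP => n _ minQ; case: ex_minnP => m /asboolP Pm _.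
exact/minQ/asboolP/PQ.
Qed.

(** Functoriality rewrites the image of the composite [cmp f s] as the composite of the images, so
    compatibility of [F] with the relations suffices. *)
Lemma fmap_is_section {C D : category} {R : hom_rel C} {R' : hom_rel D}
    {F : functor C D}
    (hFR : forall (X Y : C) (f g : hom X Y),
      R X Y f g -> R' (F X) (F Y) (fmap F f) (fmap F g))
    {X Y Z : C} {f : hom X Y} {g : hom Z Y} {s : hom Z X} :
  is_section R f g s -> is_section R' (fmap F f) (fmap F g) (fmap F s).
Proof. by move=> /hFR; rewrite fmap_cmp. Qed.

Theorem theorem3p27 (C D : cat_with_covers)
  (R : hom_rel C) (R' : hom_rel D)
  (hR : hom_equivalence R) (hR' : hom_equivalence R')
  (F : functor C D) (hF : continuous_functor F)
  (hFR : forall (X Y : C) (f g : hom X Y),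
    R X Y f g -> R' (F X) (F Y) (fmap F f) (fmap F g))
  (X Y : C) (f : hom X Y) :
  le_enat (sec R' (fmap F f)) (sec R f) /\
  (preserves_mono F -> le_enat (msec R' (fmap F f)) (msec R f)).
Proof.
split=> [|Fmono]; apply: le_least => m [m_gt0 [A [g]]].
  move=> [cov_g sec_g]; split=> //.
  (* The image family keeps the index type ['I_m], so the count is unchanged. *)
  exists (fun j => F (A j)), (fun j => fmap F (g j)).
  split=> [|j]; first exact: hF.
  by have [s /(fmap_is_section hFR)] := sec_g j; exists (fmap F s).
move=> [cov_g mono_g sec_g]; split=> //.
exists (fun j => F (A j)), (fun j => fmap F (g j)).
split=> [|j|j]; [exact: hF | exact: Fmono |].
by have [s /(fmap_is_section hFR)] := sec_g j; exists (fmap F s).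
Qed.
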